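(* Let $m\ge 1$, let $a_1,\ldots,a_m$ be positive integers, let $b_i,q_i,V_i,M_m$ be as defined in the context, and let $d_1,\ldots,d_m\in\mathbb Z$. Put $N=d_1q_0+d_2q_1+\cdots+d_mq_{m-1}$. (1) The element $V_m=V_m(d_1,\ldots,d_m)$ is conjugate within the free group $F(A)$ to $M_m$. Precisely, $V_m=h^{-1}M_mh$ for some $h\in F(A)$ of algebraic length $N$. (2) The $A^*$-conjugation class of $M_m$ is equal to the set of all $V_m(d_1,\ldots,d_m)$, for all sequences $d_1,\ldots,d_m$ satisfying $0\le d_i\le b_i$ for all $i=1,\ldots,m$; and precisely, for every such sequence, $V_m(d_1,\ldots,d_m)=C^N(M_m)$, with $N=d_1q_0+\cdots+d_mq_{m-1}$. (3) This conjugation class contains the two Christoffel words (the lower one and the upper one) of Slope $S=[0,a_1,\ldots,a_m]$.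
   Context: Let $A=\{a,b\}$, $A^*$ the free monoid and $F(A)$ the free group on $A$. For $g\in F(A)$ and $x\in A$, $|g|_x$ is the number of occurrences of $x$ in $g$, each $x^{-1}$ being counted as $-1$; the algebraic length is $|g|=|g|_a+|g|_b$ (the usual length if $g\in A^*$). Two words $u,v\in A^*$ are conjugate (in $A^*$) if $u=xy$, $v=yx$ for some $x,y\in A^*$. The conjugator $C:A^*\to A^*$ maps $xu$ ($x\in A$, $u\in A^*$) to $ux$, and $C(1)=1$ for the empty word $1$. Given positive integers $a_1,\ldots,a_m$, put $b_1=a_1-1$ and $b_i=a_i$ for $i\ge 2$; $q_{-1}=0$, $q_0=1$, $q_i=a_iq_{i-1}+q_{i-2}$ for $1\le i\le m$. For integers $d_1,\ldots,d_m$ define elements $V_i=V_i(d_1,\ldots,d_i)$ of $F(A)$ by $V_{-1}=b$, $V_0=a$, and $V_i=V_{i-1}^{\,b_i-d_i}\,V_{i-2}\,V_{i-1}^{\,d_i}$ for $i=1,\ldots,m$. If $0\le d_i\le b_i$ for all $i$, all $V_i$ lie in $A^*$. Put $M_m=V_m(0,\ldots,0)\in A^*$. The Slope of a nonempty word $w$ is $|w|_b/|w|$. $[0,a_1,\ldots,a_m]=\frac{1}{a_1+\frac{1}{a_2+\cdots+\frac1{a_m}}}$. Write $(u,v)$ for the endomorphism of $A^*$ sending $a\mapsto u$, $b\mapsto v$, and let $G=(a,ab)$, $\widetilde G=(a,ba)$, $D=(ba,b)$, $\widetilde D=(ab,b)$. A lower (resp. upper) Christoffel word is the image of $a$ or $b$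 under an element of the monoid of endomorphisms generated by $G$ and $\widetilde D$ (resp. by $\widetilde G$ and $D$). For each rational $S\in[0,1]$ there is a unique lower and a unique upper Christoffel word of Slope $S$; they are distinct if $S\ne 0,1$ and coincide if $S\in\{0,1\}$. *)

(* Defs.v *)
From HB Require Import structures.
From mathcomp Require Import all_boot all_order all_algebra.
Set Implicit Arguments.
Unset Strict Implicit.
Unset Printing Implicit Defensive.
Import Order.TTheory GRing.Theory Num.Theory.

Inductive letter := La | Lb.

Definition letter_to_bool (x : letter) := if x is La then true else false.
Definition letter_of_bool (c : bool) := if c then La else Lb.
Lemma letter_to_boolK : cancel letter_to_bool letter_of_bool.
Proof. by case. Qed.

HB.instance Definition _ := Countable.copy letter (can_type letter_to_boolK).

Definition word := seq letter.

(** The free group on [letter], realized as the set of reduced words.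
    A signed letter [(x, s)] stands for x if [s = false], for x^-1 if
    [s = true]. *)
Definition sletter := (letter * bool)%type.
Definition sinv (l : sletter) : sletter := (l.1, ~~ l.2).
Definition reduced (s : seq sletter) := sorted (fun l l' => l' != sinv l) s.

Record fgroup := FGroup { fgval :> seq sletter; _ : reduced fgval }.
HB.instance Definition _ := [isSub for fgval].
HB.instance Definition _ := [Countable of fgroup by <:].

Definition cons_red (l : sletter) (s : seq sletter) :=
  if s is l' :: s' then if l' == sinv l then s' else l :: s else [:: l].
Definition cat_red (s t : seq sletter) := foldr cons_red t s.
Definition inv_red (s : seq sletter) := rev (map sinv s).

Lemma sinvK : involutive sinv.
Proof. by case=> x s; rewrite /sinv /= negbK. Qed.

Lemma cons_red_reduced l s : reduced s -> reduced (cons_red l s).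
Proof.
case: s => [//|l' s] /= red_s; case: ifP => [_|ne].
  exact: path_sorted red_s.
by rewrite /reduced /= ne.
Qed.

Lemma cat_red_reduced s t : reduced t -> reduced (cat_red s t).
Proof. by move=> red_t; elim: s => //= l s; apply: cons_red_reduced. Qed.

Lemma cons_redK l s : reduced s -> cons_red l (cons_red (sinv l) s) = s.
Proof.
case: s => [_|l' s] /=; first by rewrite eqxx.
rewrite sinvK; case: eqP => [-> |ne] red_s; last by rewrite /= eqxx.
by case: s red_s => [//|l2 s] /= /andP[/negbTE ->].
Qed.

Lemma cat_red_rcons l s t :
  reduced t -> cat_red (cons_red l s) t = cons_red l (cat_red s t).
Proof.
move=> red_t; case: s => [//|l' s] /=; case: eqP => [->|//].
by rewrite cons_redK // cat_red_reduced.
Qed.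

Lemma cat_redA s t u :
  reduced u -> cat_red s (cat_red t u) = cat_red (cat_red s t) u.
Proof. by move=> red_u; elim: s => //= l s ->; rewrite cat_red_rcons. Qed.

Lemma cat_red_id s t : reduced (s ++ t) -> cat_red s t = s ++ t.
Proof.
elim: s => //= l s IHs red_st; rewrite IHs; last exact: path_sorted red_st.
by case: (s ++ t) red_st => [//|l' s'] /= /andP[/negbTE ->].
Qed.

Lemma inv_red_reduced s : reduced s -> reduced (inv_red s).
Proof.
rewrite /reduced /inv_red rev_sorted sorted_map.
case: s => //= l s; elim: s l => //= l' s IHs l /andP[ne /IHs ->].
by rewrite andbT /= sinvK eq_sym.
Qed.

Lemma cat_red_inv s : reduced s -> cat_red s (inv_red s) = [::].
Proof.
rewrite /inv_red => red_s.
suff cat_red_rev t : reduced s -> reduced t ->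
    cat_red s (cat_red (rev (map sinv s)) t) = t.
  have := cat_red_rev [::] red_s isT.
  rewrite (@cat_red_id _ [::]) ?cats0 //; exact: inv_red_reduced.
move=> {}red_s; elim: s red_s t => //= l s IHs red_s t red_t.
rewrite rev_cons -cats1 /cat_red foldr_cat /= -!/(cat_red _ _).
rewrite IHs ?cons_red_reduced //.
  exact: cons_redK.
exact: path_sorted red_s.
Qed.

Lemma inv_redK : involutive inv_red.
Proof.
by move=> s; rewrite /inv_red map_rev revK -map_comp map_id_in // => l _;
   rewrite /= sinvK.
Qed.

Lemma fgvalP (g : fgroup) : reduced g.
Proof. by case: g. Qed.

Definition fg_one : fgroup := @FGroup [::] isT.
Definition fg_mul (g h : fgroup) : fgroup :=
  FGroup (cat_red_reduced g (fgvalP h)).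
Definition fg_inv (g : fgroup) : fgroup := FGroup (inv_red_reduced (fgvalP g)).

Lemma fg_mulA : associative fg_mul.
Proof. by move=> g h k; apply: val_inj; apply: cat_redA (fgvalP k). Qed.
Lemma fg_mul1g : left_id fg_one fg_mul.
Proof. by move=> g; apply: val_inj. Qed.
Lemma fg_mulg1 : right_id fg_one fg_mul.
Proof.
move=> g; apply: val_inj; rewrite /= cat_red_id ?cats0 //; exact: fgvalP.
Qed.
Lemma fg_mulgV : right_inverse fg_one fg_inv fg_mul.
Proof. by move=> g; apply: val_inj; apply: cat_red_inv (fgvalP g). Qed.
Lemma fg_mulVg : left_inverse fg_one fg_inv fg_mul.
Proof.
move=> g; apply: val_inj => /=; rewrite -[X in cat_red _ X]inv_redK.
exact: cat_red_inv (inv_red_reduced (fgvalP g)).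
Qed.

HB.instance Definition _ :=
  isGroup.Build fgroup fg_mulA fg_mul1g fg_mulg1 fg_mulVg fg_mulgV.

Lemma embed_subproof (w : word) : reduced [seq (x, false) | x <- w].
Proof.
rewrite /reduced sorted_map; case: w => //= x w.
by elim: w x => //= y w IHw x; rewrite IHw andbT xpair_eqE andbF.
Qed.

(** The inclusion of A^* in F(A), and its left inverse, which forgets the
    signs. *)
Definition embed (w : word) : fgroup := FGroup (embed_subproof w).
Definition to_word (g : fgroup) : word := [seq l.1 | l <- fgval g].

Definition zexp (g : fgroup) (n : int) : fgroup :=
  match n with Posz k => (g ^+ k)%g | Negz k => (g ^- k.+1)%g end.

Section IntegerPart.
Local Open Scope ring_scope.

Definition occ (x : letter) (g : fgroup) : int :=
  (count_mem (x, false) (fgval g))%:Z - (count_mem (x, true) (fgval g))%:Z.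
Definition alglen (g : fgroup) : int := occ La g + occ Lb g.

(** Sequences indexed by 1, ..., m are functions on [nat] of which only the
    values at 1, ..., m are used. *)
Definition bseq (a : nat -> nat) (i : nat) : int :=
  if i == 1%N then (a i)%:Z - 1 else (a i)%:Z.

Fixpoint qseq (a : nat -> nat) (i : nat) : nat :=
  match i with
  | 0 => 1
  | j.+1 => (a j.+1 * qseq a j + if j is k.+1 then qseq a k else 0)%N
  end.

Fixpoint V (a : nat -> nat) (d : nat -> int) (i : nat) : fgroup :=
  match i with
  | 0 => embed [:: La]
  | j.+1 =>
      (zexp (V a d j) (bseq a j.+1 - d j.+1)
       * (if j is k.+1 then V a d k else embed [:: Lb])
       * zexp (V a d j) (d j.+1))%g
  end.

Definition Nsum (a : nat -> nat) (d : nat -> int) (m : nat) : int :=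
  \sum_(1 <= i < m.+1) d i * (qseq a i.-1)%:Z.

Definition admissible (a : nat -> nat) (m : nat) (d : nat -> int) :=
  forall i, (1 <= i <= m)%N -> 0 <= d i <= bseq a i.

(** Forgetting the signs loses nothing here: see [embed_Mword] below. *)
Definition Mword (a : nat -> nat) (m : nat) : word :=
  to_word (V a (fun=> 0) m).

Lemma to_wordK w : to_word (embed w) = w.
Proof. by rewrite /to_word /= -map_comp map_id. Qed.

Lemma embed_inj : injective embed.
Proof. exact: can_inj to_wordK. Qed.

Lemma embed_cat u v : embed (u ++ v) = (embed u * embed v)%g.
Proof.
apply: val_inj; rewrite /= map_cat cat_red_id // -map_cat; exact: embed_subproof.
Qed.

Lemma embed_zexp w n : 0 <= n -> exists w', zexp (embed w) n = embed w'.
Proof.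
case: n => // n _ /=; exists (flatten (nseq n w)).
elim: n => [|n IHn]; first exact: val_inj.
by rewrite expgS IHn /= embed_cat.
Qed.

Lemma V_word a d m : admissible a m d -> exists w, V a d m = embed w.
Proof.
move=> adm_d; suff: (exists w, V a d m = embed w) /\
    (exists w, (if m is k.+1 then V a d k else embed [:: Lb]) = embed w) by case.
elim: m adm_d => [|j IHj] adm_d /=.
  by split; [exists [:: La] | exists [:: Lb]].
case: IHj => [i /andP[i_gt0 /leqW i_le]|[v Vv] [u Vu]].
  by apply: adm_d; rewrite i_gt0.
split; last by exists v.
have /adm_d/andP[d_ge0 d_le] : (1 <= j.+1 <= j.+1)%N by rewrite leqnn.
rewrite Vu Vv; have [|w1 ->] := @embed_zexp v (bseq a j.+1 - d j.+1).
  by rewrite subr_ge0.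
have [//|w2 ->] := @embed_zexp v (d j.+1).
by exists ((w1 ++ u) ++ w2); rewrite !embed_cat.
Qed.

Lemma embed_Mword a m :
  (forall i, (1 <= i <= m)%N -> (0 < a i)%N) ->
  embed (Mword a m) = V a (fun=> 0) m.
Proof.
move=> a_gt0; rewrite /Mword; have [i /a_gt0 ai|w ->] := @V_word a (fun=> 0) m.
  by rewrite lexx /bseq; case: eqP; rewrite ?subr_ge0.
by rewrite to_wordK.
Qed.

Definition conj_words (u v : word) := exists x y, u = x ++ y /\ v = y ++ x.

Definition conjugator (w : word) : word :=
  if w is x :: u then rcons u x else [::].

(** [0, a_1, ..., a_m] for [s = [:: a_1; ...; a_m]]. *)
Definition cfrac (s : seq nat) : rat := foldr (fun x r => (x%:R + r)^-1) 0 s.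

Definition slope (w : word) : rat := (count_mem Lb w)%:R / (size w)%:R.

(** The endomorphism written (u, v): a is mapped to u and b to v. *)
Definition endo (u v : word) (w : word) : word :=
  flatten [seq (if x is La then u else v) | x <- w].

Definition morG := endo [:: La] [:: La; Lb].
Definition morG' := endo [:: La] [:: Lb; La].
Definition morD := endo [:: Lb; La] [:: Lb].
Definition morD' := endo [:: La; Lb] [:: Lb].

Inductive gen_monoid (f g : word -> word) : (word -> word) -> Prop :=
  | gen_id : gen_monoid f g id
  | gen_l : gen_monoid f g f
  | gen_r : gen_monoid f g g
  | gen_comp h k :
      gen_monoid f g h -> gen_monoid f g k -> gen_monoid f g (h \o k).

Definition lower_christoffel (w : word) :=
  exists f x, gen_monoid morG morD' f /\ w = f [:: x].
Definition upper_christoffel (w : word) :=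
  exists f x, gen_monoid morG' morD f /\ w = f [:: x].

End IntegerPart.

(* Main.v *)
Require Import Defs.
From mathcomp Require Import all_boot all_order all_algebra.
From mathcomp Require Import zify.
Set Implicit Arguments.
Unset Strict Implicit.
Unset Printing Implicit Defensive.
Import Order.TTheory GRing.Theory Num.Theory.
Local Open Scope ring_scope.

(**
The recursion conjugates consecutive terms simultaneously.  If one element h
conjugates M_(i-1) and M_(i-2) to V_(i-1) and V_(i-2), then

  V_i = V_(i-1)^(-d_i) (V_(i-1)^(b_i) V_(i-2)) V_(i-1)^(d_i)

shows that h V_(i-1)^(d_i) conjugates M_i to V_i; it also conjugates M_(i-1)
to V_(i-1), because the factor added commutes with V_(i-1).  So
h = V_0^(d_1) V_1^(d_2) ... V_(m-1)^(d_m) conjugates M_m to V_m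
([V_conjugating]), and as V_i has algebraic length q_i, that of h is N.

For admissible d all the factors are words, so h is a word of length N with
M h = h V.  In the free monoid such an equation says that V is obtained from M
by |h| successive applications of the conjugator ([cat_eq_conjugator]).  The
numbers N cover the interval from 0 to q_m + q_(m-1) - 2 by the greedy algorithm
([greedy_digits]), and as |M| = q_m this interval already contains enough
exponents to reach every conjugate of M.

For Christoffel words, the four endomorphisms G, G~, D, D~ define only two maps
on conjugacy classes, since G w is conjugate to G~ w and D w to D~ w.  Hence, up
to conjugation, lower and upper Christoffel words alike are the words obtained
from a letter by G and D.  Such a word is determined up to conjugation by its
Slope, because its numbers of letters allow the applications of G and D to be
undone by the subtractive Euclidean algorithm ([GD_conj]).  On the other
hand the recursion for M_m says that M_m is the image of a under the
composition of the G^(b_i) E, where E exchanges the two letters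
([Mword_expand]); since E G = D E, M_m is obtained from a letter by G and D.
Reading the same composition from its first factor gives the continued fraction
for the Slope of M_m ([slope_Mword]).
*)

(** * Algebraic length and integer powers in the free group *)

(** The algebraic length as a single signed sum, with no reference to the two
    letters: in this form a cancellation visibly preserves it. *)
Definition alglen_seq (s : seq sletter) : int :=
  \sum_(l <- s) (if l.2 then -1 else 1).

Lemma alglenE g : alglen g = alglen_seq (fgval g).
Proof.
rewrite /alglen /occ /alglen_seq; elim: (fgval g) => [|[x s] t IHt] /=.
  by rewrite big_nil.
by rewrite big_cons -IHt; case: x; case: s => /=; lia.
Qed.

Lemma alglen_cons_red l s :
  alglen_seq (cons_red l s) = (if l.2 then -1 else 1) + alglen_seq s.
Proof.
rewrite /alglen_seq; case: s => [|l' s] /=; first by rewrite big_seq1 big_nil addr0.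
case: eqP => [->|_]; rewrite !big_cons //=.
by case: l.2; rewrite /= addrA ?addNr ?subrr add0r.
Qed.

Lemma alglenM g h : alglen (g * h)%g = alglen g + alglen h.
Proof.
rewrite !alglenE /=; elim: (fgval g) => [|l s IHs] /=.
  by rewrite /alglen_seq big_nil add0r.
by rewrite alglen_cons_red IHs addrA /alglen_seq big_cons.
Qed.

Lemma alglen1 : alglen 1%g = 0.
Proof. by rewrite alglenE /alglen_seq big_nil. Qed.

Lemma alglen_embed w : alglen (embed w) = (size w)%:Z.
Proof.
rewrite alglenE /alglen_seq /= big_map /=.
by rewrite big_const_seq count_predT iter_addr_0 -natz.
Qed.

Lemma zexpSr g n : zexp g (n + 1) = (zexp g n * g)%g.
Proof.
case: n => [n|[|n]].
- by rewrite -PoszD addn1 /= expgSr.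
- by rewrite /= mulVg.
- have -> : Negz n.+1 + 1 = Negz n by lia.
  by rewrite /= (expgS g n.+1) invgM mulgVK.
Qed.

Lemma zexpD g m n : zexp g (m + n) = (zexp g m * zexp g n)%g.
Proof.
elim/int_rec: n => [|n IHn|n IHn]; first by rewrite addr0 /= mulg1.
  by rewrite -addn1 PoszD addrA !zexpSr IHn mulgA.
apply: (mulIg g); rewrite -mulgA -!zexpSr.
have -> : m - n.+1%:Z + 1 = m - n%:Z by lia.
by have -> : - n.+1%:Z + 1 = - n%:Z by lia.
Qed.

Lemma zexpN g n : zexp g (- n) = ((zexp g n)^-1)%g.
Proof. by apply/esym/mulg1_eq; rewrite -zexpD subrr. Qed.

Lemma zexpJ g h n : zexp (g ^ h)%g n = (zexp g n ^ h)%g.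
Proof. by case: n => n /=; rewrite ?conjVg conjXg. Qed.

Lemma alglen_zexp g n : alglen (zexp g n) = n * alglen g.
Proof.
elim/int_rec: n => [|n IHn|n IHn]; first by rewrite mul0r alglen1.
  by rewrite -addn1 PoszD zexpSr alglenM IHn mulrDl mul1r.
apply: (addIr (alglen g)); rewrite -alglenM -zexpSr.
have -> : - n.+1%:Z + 1 = - n%:Z by lia.
by rewrite IHn; lia.
Qed.

(** * Conjugating elements in the free group *)

(** The convention V_(-1) = b makes the recursion uniform from the first step. *)
Definition Vprev (a : nat -> nat) (d : nat -> int) (i : nat) : fgroup :=
  if i is k.+1 then V a d k else embed [:: Lb].

Lemma VS a d j :
  V a d j.+1 = (zexp (V a d j) (Defs.bseq a j.+1 - d j.+1) * Vprev a d j
                * zexp (V a d j) (d j.+1))%g.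
Proof. by []. Qed.

Fixpoint conjugating (a : nat -> nat) (d : nat -> int) (i : nat) : fgroup :=
  if i is j.+1 then (conjugating a d j * zexp (V a d j) (d j.+1))%g else 1%g.

(** Carrying two consecutive terms is what makes the induction work:
    conjugation by the new factor V_(i-1)^(d_i) fixes V_(i-1) and turns
    V_(i-1)^(b_i) V_(i-2) into V_i. *)
Lemma V_conjugating a d m :
  V a d m = (V a (fun=> 0%R) m ^ conjugating a d m)%g /\
  Vprev a d m = (Vprev a (fun=> 0%R) m ^ conjugating a d m)%g.
Proof.
elim: m => [|j [IHV IHp]]; first by rewrite !conjg1.
rewrite [conjugating _ _ _]/= !VS subr0 mulg1 !conjgM.
split.
  rewrite (conjMg _ _ (conjugating a d j)) -zexpJ -IHV -IHp conjgE -zexpN !mulgA -zexpD.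
  by rewrite [- _ + _]addrC.
have zexpC : (V a d j * zexp (V a d j) (d j.+1) =
              zexp (V a d j) (d j.+1) * V a d j)%g.
  by rewrite -zexpSr addrC zexpD.
by rewrite /= -IHV conjgE zexpC mulKg.
Qed.

Lemma qseqS a j :
  qseq a j.+1 = (a j.+1 * qseq a j + if j is k.+1 then qseq a k else 0)%N.
Proof. by []. Qed.

(** The exponents b_i - d_i and d_i add up to b_i whatever d is, so the length
    follows the recursion of the q_i; the defect b_1 = a_1 - 1 is compensated
    by the length 1 of V_(-1), where q_(-1) = 0. *)
Lemma alglen_V a d m :
  alglen (V a d m) = (qseq a m)%:Z /\
  alglen (Vprev a d m) = if m is k.+1 then (qseq a k)%:Z else 1.
Proof.
elim: m => [|j [IHV IHp]]; first by rewrite !alglen_embed.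
split=> //; rewrite VS qseqS !alglenM !alglen_zexp IHV IHp /Defs.bseq.
by case: j {IHV IHp} => [|j] /=; lia.
Qed.

Lemma NsumS a d j : Nsum a d j.+1 = Nsum a d j + d j.+1 * (qseq a j)%:Z.
Proof. by rewrite /Nsum big_nat_recr. Qed.

Lemma alglen_conjugating a d m : alglen (conjugating a d m) = Nsum a d m.
Proof.
elim: m => [|j IHj]; first by rewrite alglen1 /Nsum big_geq.
by rewrite NsumS alglenM IHj alglen_zexp (alglen_V a d j).1.
Qed.

Lemma admissibleS a m d : admissible a m.+1 d -> admissible a m d.
Proof. by move=> adm i /andP[i_gt0 /leqW i_le]; apply: adm; rewrite i_gt0. Qed.

Lemma conjugating_word a m d :
  admissible a m d -> exists w, conjugating a d m = embed w.
Proof.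
elim: m => [|j IHj] adm; first by exists [::]; apply: val_inj.
have [u /= ->] := IHj (admissibleS adm).
have [v ->] := V_word (admissibleS adm).
have /adm/andP[d_ge0 _] : (1 <= j.+1 <= j.+1)%N by rewrite leqnn.
have [w ->] := embed_zexp v d_ge0.
by exists (u ++ w); rewrite embed_cat.
Qed.

(** * Conjugate words *)

(** Such a word h is a prefix of a power of u, so u and h have the same first
    letter when neither is empty: removing this letter from h and moving it to
    the end of u preserves the equation. *)
Lemma cat_eq_conjugator u h v :
  u ++ h = h ++ v -> v = iter (size h) conjugator u.
Proof.
elim: h u => [|x h IHh] u; first by rewrite cats0.
case: u => [|y u] /= [].
  move=> /(congr1 size)/eqP; rewrite size_cat -{1}[size h]addn0 eqn_add2l.
  by case: v {IHh} => // _; elim: (size h) => //= n <-.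
by move=> -> E; rewrite -iterS iterSr; apply: IHh; rewrite cat_rcons.
Qed.

Lemma conj_iter_conjugator u n : conj_words u (iter n conjugator u).
Proof.
elim: n => [|n [x [y [Eu Ew]]]] /=; first by exists u, [::]; rewrite cats0.
rewrite {}Ew {}Eu; case: y => [|c y].
  case: x => [|c x]; first by exists [::], [::].
  by exists [:: c], x; rewrite cats0 /= cats1.
by exists (x ++ [:: c]), y; rewrite /= -!catA rcons_cat cats1.
Qed.

(** In this form conjugacy is transitive by mere concatenation of the
    intertwining words, with no discussion of how the factors overlap. *)
Lemma conj_wordsP u v : conj_words u v <-> exists h, u ++ h = h ++ v.
Proof.
split=> [[x [y [-> ->]]]|[h /cat_eq_conjugator ->]]; last exact: conj_iter_conjugator.
by exists x; rewrite catA.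
Qed.

Lemma conj_words_refl u : conj_words u u.
Proof. by exists [::], u; rewrite cats0. Qed.

Lemma conj_words_sym u v : conj_words u v -> conj_words v u.
Proof. by case=> x [y [-> ->]]; exists y, x. Qed.

Lemma conj_words_trans v u w :
  conj_words u v -> conj_words v w -> conj_words u w.
Proof.
move=> /conj_wordsP[h Eh] /conj_wordsP[k Ek]; apply/conj_wordsP.
by exists (h ++ k); rewrite catA Eh -!catA Ek.
Qed.

Lemma conj_words_iter_lt u v : u != [::] -> conj_words u v ->
  exists2 n, (n < size u)%N & v = iter n conjugator u.
Proof.
move=> u0 [x [[|c y] [Eu Ev]]].
  by exists 0%N; rewrite ?lt0n ?size_eq0 // Eu Ev cats0.
exists (size x); first by rewrite Eu size_cat /= addnS ltnS leq_addr.
by apply: cat_eq_conjugator; rewrite Eu Ev catA.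
Qed.

(** * The conjugation class and its digits *)

(** For admissible digits the conjugating element is a word h, and the equation
    M h = h V holds between words, the inclusion of the free monoid in the
    free group being injective. *)
Lemma V_eq_iter_conjugator a m d :
  (forall i, (1 <= i <= m)%N -> (0 < a i)%N) -> admissible a m d ->
  V a d m = embed (iter `|Nsum a d m|%N conjugator (Mword a m)).
Proof.
move=> ha adm; have [w Ew] := V_word adm; have [h Eh] := conjugating_word adm.
rewrite -alglen_conjugating Eh alglen_embed absz_nat Ew.
congr embed; apply/cat_eq_conjugator/embed_inj.
rewrite !embed_cat embed_Mword // -Ew (V_conjugating a d m).1 Eh.
exact: conjgC.
Qed.

Lemma size_Mword a m :
  (forall i, (1 <= i <= m)%N -> (0 < a i)%N) -> size (Mword a m) = qseq a m.
Proof.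
move=> ha; apply/eqP; rewrite -eqz_nat -alglen_embed embed_Mword //.
by rewrite (alglen_V _ _ _).1.
Qed.

Lemma qseq_gt0 a m :
  (forall i, (1 <= i <= m)%N -> (0 < a i)%N) -> (0 < qseq a m)%N.
Proof.
elim: m => [//|j IHj] ha; rewrite qseqS addn_gt0 muln_gt0 ha ?leqnn //=.
by rewrite IHj // => i /andP[? /leqW ?]; apply: ha; apply/andP.
Qed.

(** The top digit is the quotient of n by q_(m-1), capped at a_m.  When the cap
    acts, the remainder is bounded through q_m = a_m q_(m-1) + q_(m-2); otherwise
    it is less than q_(m-1).  In both cases it is at most
    q_(m-1) + q_(m-2) - 2, which is the hypothesis for the lower digits. *)
Lemma greedy_digits a m n : (1 <= m)%N ->
  (forall i, (1 <= i <= m)%N -> (0 < a i)%N) ->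
  (n.+1 < qseq a m + qseq a m.-1)%N ->
  exists2 d, admissible a m d & Nsum a d m = n%:Z.
Proof.
case: m => // m _; elim: m n => [|m IHm] n ha lt_n.
  exists (fun=> n%:Z).
    move=> [|[|i]] // _; rewrite /Defs.bseq /=.
    by move: lt_n (ha 1%N isT) => /=; lia.
  by rewrite NsumS /Nsum big_geq //= mulr1 add0r.
have ha' i : (1 <= i <= m.+1)%N -> (0 < a i)%N.
  by move=> /andP[? /leqW ?]; apply: ha; apply/andP.
have q_gt0 := qseq_gt0 ha'.
pose c := minn (a m.+2) (n %/ qseq a m.+1).
have le_cn : (c * qseq a m.+1 <= n)%N.
  by rewrite (leq_trans _ (leq_trunc_div n (qseq a m.+1))) // leq_mul2r geq_minr orbT.
have [|d adm Ed] := IHm (n - c * qseq a m.+1)%N ha'.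
  have q'_gt0 : (0 < qseq a m)%N by apply: qseq_gt0 => i /andP[? /leqW ?]; apply/ha'/andP.
  move: lt_n (ltn_ceil n q_gt0); rewrite [m.+2.-1]/= [m.+1.-1]/=  qseqS /c.
  move: (qseq a m.+1) (qseq a m) (a m.+2) q_gt0 q'_gt0 => Q P A Q0 P0.
  case: (leqP A (n %/ Q)) => _; nia.
exists (fun i => if i == m.+2 then c%:Z else d i).
  move=> i /andP[i_gt0 i_le]; case: eqP => [->|/eqP ne].
    by rewrite /Defs.bseq /= lez_nat geq_minl.
  by apply: adm; rewrite i_gt0 -ltnS ltn_neqAle ne.
rewrite NsumS eqxx.
have -> : Nsum a (fun i => if i == m.+2 then c%:Z else d i) m.+1 = Nsum a d m.+1.
  by apply: eq_big_nat => i /andP[_ lt_i]; rewrite ltn_eqF.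
by rewrite Ed -PoszM -PoszD subnK.
Qed.

Lemma conj_Mword_digits a m w : (1 <= m)%N ->
  (forall i, (1 <= i <= m)%N -> (0 < a i)%N) ->
  conj_words (Mword a m) w <->
  exists d, admissible a m d /\ V a d m = embed w.
Proof.
move=> hm ha; split=> [cMw|[d [adm]]]; last first.
  by rewrite V_eq_iter_conjugator // => /embed_inj <-; apply: conj_iter_conjugator.
have [|n lt_n ->] := conj_words_iter_lt _ cMw.
  by rewrite -size_eq0 size_Mword // -lt0n qseq_gt0.
have [|d adm Ed] := greedy_digits hm ha (n := n).
  have : (0 < qseq a m.-1)%N.
    apply: qseq_gt0 => i /andP[i_gt0 i_le]; apply: ha.
    by rewrite i_gt0 (leq_trans i_le) ?leq_pred.
  by move: lt_n; rewrite size_Mword //; lia.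
by exists d; rewrite V_eq_iter_conjugator // Ed absz_nat.
Qed.

(** * Christoffel words up to conjugation *)

Lemma endo_cat u v w1 w2 : endo u v (w1 ++ w2) = endo u v w1 ++ endo u v w2.
Proof. by rewrite /endo map_cat flatten_cat. Qed.

Lemma count_endo p u v w :
  count p (endo u v w) =
  (count_mem La w * count p u + count_mem Lb w * count p v)%N.
Proof.
rewrite /endo; elim: w => [//|x w IHw] /=; rewrite count_cat IHw.
by case: x => /=; lia.
Qed.

Lemma size_count w : size w = (count_mem La w + count_mem Lb w)%N.
Proof. by elim: w => [//|[] w /= ->]; rewrite ?addnS. Qed.

Lemma conj_words_count p u v : conj_words u v -> count p u = count p v.
Proof. by case=> x [y [-> ->]]; rewrite !count_cat addnC. Qed.

Lemma conj_words_slope u v : conj_words u v -> slope u = slope v.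
Proof.
by move=> cuv; rewrite /slope !size_count !(conj_words_count _ cuv).
Qed.

Lemma conj_words_endo s t u v :
  conj_words u v -> conj_words (endo s t u) (endo s t v).
Proof. by case=> x [y [-> ->]]; rewrite !endo_cat; exists (endo s t x), (endo s t y). Qed.

Lemma endo_cons u v x w :
  endo u v (x :: w) = (if x is La then u else v) ++ endo u v w.
Proof. by []. Qed.

(** Both morphisms satisfy G(x) a = a G~(x) on letters, hence on words. *)
Lemma conj_morG w : conj_words (morG w) (morG' w).
Proof.
apply/conj_wordsP; exists [:: La].
by elim: w => [//|x w]; rewrite /morG /morG' !endo_cons -catA => ->; case: x.
Qed.

(** As before, with D(x) b = b D~(x). *)
Lemma conj_morD w : conj_words (morD w) (morD' w).
Proof.
apply/conj_wordsP; exists [:: Lb].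
by elim: w => [//|x w]; rewrite /morD /morD' !endo_cons -catA => ->; case: x.
Qed.

Lemma count_morG w :
  count_mem La (morG w) = (count_mem La w + count_mem Lb w)%N /\
  count_mem Lb (morG w) = count_mem Lb w.
Proof. by rewrite /morG !count_endo /=; lia. Qed.

Lemma count_morD w :
  count_mem La (morD w) = count_mem La w /\
  count_mem Lb (morD w) = (count_mem La w + count_mem Lb w)%N.
Proof. by rewrite /morD !count_endo /=; lia. Qed.

(** Representatives of the conjugacy classes of all Christoffel words. *)
Inductive GD_word : word -> Prop :=
  | GD_letter x : GD_word [:: x]
  | GD_G w : GD_word w -> GD_word (morG w)
  | GD_D w : GD_word w -> GD_word (morD w).

Lemma GD_count_gt0 w :
  GD_word w -> (0 < count_mem La w + count_mem Lb w)%N.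
Proof.
elim=> {w} [[]//|w _ IHw|w _ IHw].
  by have [-> ->] := count_morG w; lia.
by have [-> ->] := count_morD w; lia.
Qed.

Lemma GD_no_b w : GD_word w -> count_mem Lb w = 0%N -> w = [:: La].
Proof.
elim=> {w} [[]//|w _ IHw|w bw _].
  by have [_ ->] := count_morG w => /IHw ->.
by have [_ ->] := count_morD w; have := GD_count_gt0 bw; lia.
Qed.

Lemma GD_no_a w : GD_word w -> count_mem La w = 0%N -> w = [:: Lb].
Proof.
elim=> {w} [[]//|w bw _|w _ IHw].
  by have [-> _] := count_morG w; have := GD_count_gt0 bw; lia.
by have [-> _] := count_morD w => /IHw ->.
Qed.

(** A word G u has at least as many a as b, and D v at least as many b as a.
    If the ratios agree then both have as many a as b, which forces u = b and
    v = a: the two words are ab and ba, the only place where the two branches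
    of the Euclidean algorithm meet. *)
Lemma conj_morG_morD u v : GD_word u -> GD_word v ->
  (count_mem La (morG u) * count_mem Lb (morD v) =
   count_mem La (morD v) * count_mem Lb (morG u))%N ->
  conj_words (morG u) (morD v).
Proof.
move=> bu bv; have [-> ->] := count_morG u; have [-> ->] := count_morD v.
move: (GD_count_gt0 bu) (GD_count_gt0 bv) => u_gt0 v_gt0 E.
have u0 : count_mem La u = 0%N by nia.
have v0 : count_mem Lb v = 0%N by nia.
rewrite (GD_no_a bu u0) (GD_no_b bv v0).
by exists [:: La], [:: Lb].
Qed.

(** The proportionality of the numbers of letters is invariant under G applied
    to both words, and under D applied to both; so when the outermost
    morphisms of u and v agree they can be removed. *)
Lemma GD_conj u v : GD_word u -> GD_word v ->
  (count_mem La u * count_mem Lb v = count_mem La v * count_mem Lb u)%N ->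
  conj_words u v.
Proof.
move=> bu; elim: bu v => {u} [[]|u bu IHu|u bu IHu] v bv.
- rewrite /= mul1n muln0 => v0; rewrite (GD_no_b bv v0).
  exact: conj_words_refl.
- rewrite /= mul0n muln1 => /esym v0; rewrite (GD_no_a bv v0).
  exact: conj_words_refl.
- case: bv => {v} [[]|v bv|v bv]; last exact: conj_morG_morD.
  + rewrite /= muln0 mul1n => /esym u0.
    rewrite (GD_no_b (GD_G bu) u0); exact: conj_words_refl.
  + rewrite /= mul0n muln1 => u0.
    rewrite (GD_no_a (GD_G bu) u0); exact: conj_words_refl.
  + have [-> ->] := count_morG u; have [-> ->] := count_morG v => E.
    by apply: conj_words_endo; apply: IHu => //; lia.
- case: bv => {v} [[]|v bv|v bv].
  + rewrite /= muln0 mul1n => /esym u0.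
    rewrite (GD_no_b (GD_D bu) u0); exact: conj_words_refl.
  + rewrite /= mul0n muln1 => u0.
    rewrite (GD_no_a (GD_D bu) u0); exact: conj_words_refl.
  + by move=> E; apply: conj_words_sym; apply: conj_morG_morD.
  + have [-> ->] := count_morD u; have [-> ->] := count_morD v => E.
    by apply: conj_words_endo; apply: IHu => //; lia.
Qed.

Lemma slope_eq_cross u v : u != [::] -> v != [::] -> slope u = slope v ->
  (count_mem La u * count_mem Lb v = count_mem La v * count_mem Lb u)%N.
Proof.
rewrite -!size_eq0 -!(pnatr_eq0 rat) /slope => u0 v0 /eqP.
by rewrite eqr_div // -!natrM eqr_nat !size_count => /eqP; lia.
Qed.

Lemma GD_word_conj_slope u v :
  GD_word u -> GD_word v -> slope u = slope v -> conj_words u v.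
Proof.
move=> bu bv Euv; apply: GD_conj => //; apply: slope_eq_cross => //.
  by rewrite -size_eq0 size_count -lt0n GD_count_gt0.
by rewrite -size_eq0 size_count -lt0n GD_count_gt0.
Qed.

(** Taking g and h up to conjugation treats the lower generators (G, D~) and
    the upper ones (G~, D) at once, here and in the next two lemmas. *)
Lemma gen_monoid_conj_GD (g h : word -> word)
    (conj_g : forall w, conj_words (morG w) (g w))
    (conj_h : forall w, conj_words (morD w) (h w)) f w :
  gen_monoid g h f ->
  (exists2 u, GD_word u & conj_words u w) ->
  exists2 u, GD_word u & conj_words u (f w).
Proof.
move=> gf; elim: gf w => {f} [||| f1 f2 _ IH1 _ IH2] w //.
- case=> u bu cu; exists (morG u); first exact: GD_G.
  exact: conj_words_trans (conj_words_endo _ _ cu) (conj_g w).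
- case=> u bu cu; exists (morD u); first exact: GD_D.
  exact: conj_words_trans (conj_words_endo _ _ cu) (conj_h w).
- by move=> /IH2 /IH1.
Qed.

Lemma gen_monoid_of_GD (g h : word -> word)
    (conj_g : forall w, conj_words (morG w) (g w))
    (conj_h : forall w, conj_words (morD w) (h w)) u :
  GD_word u ->
  exists f x, gen_monoid g h f /\ conj_words u (f [:: x]).
Proof.
elim=> {u} [x|u _ [f [x [gf cf]]]|u _ [f [x [gf cf]]]].
- by exists id, x; split; [apply: gen_id | apply: conj_words_refl].
- exists (g \o f), x; split; first exact: gen_comp (gen_l _ _) gf.
  exact: conj_words_trans (conj_words_endo _ _ cf) (conj_g _).
- exists (h \o f), x; split; first exact: gen_comp (gen_r _ _) gf.
  exact: conj_words_trans (conj_words_endo _ _ cf) (conj_h _).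
Qed.

Lemma christoffel_of_GD (g h : word -> word)
    (conj_g : forall w, conj_words (morG w) (g w))
    (conj_h : forall w, conj_words (morD w) (h w)) u :
  GD_word u ->
  (exists w, (exists f x, gen_monoid g h f /\ w = f [:: x]) /\
             slope w = slope u) /\
  (forall w, (exists f x, gen_monoid g h f /\ w = f [:: x]) ->
             slope w = slope u -> conj_words u w).
Proof.
move=> bu; split.
  have [f [x [gf cf]]] := gen_monoid_of_GD conj_g conj_h bu.
  exists (f [:: x]); split; first by exists f, x.
  exact/esym/conj_words_slope.
move=> w [f [x [gf ->]]] Ew.
have [|v bv cv] := gen_monoid_conj_GD conj_g conj_h gf (w := [:: x]).
  by exists [:: x]; [apply: GD_letter | apply: conj_words_refl].
apply: (conj_words_trans _ cv); apply: GD_word_conj_slope => //.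
by rewrite -Ew (conj_words_slope cv).
Qed.

(** * Factorization of M and continued fractions *)

(** Written E in the formulas. *)
Definition swap : word -> word := endo [:: Lb] [:: La].

(** Conjugation by E exchanges G and D; therefore words built with G and E are
    built with G and D. *)
Lemma swap_morG w : swap (morG w) = morD (swap w).
Proof.
by elim: w => [//|x w IHw]; rewrite /morG endo_cons /swap endo_cat -/swap IHw; case: x.
Qed.

Lemma swap_morD w : swap (morD w) = morG (swap w).
Proof.
by elim: w => [//|x w IHw]; rewrite /morD endo_cons /swap endo_cat -/swap IHw; case: x.
Qed.

Lemma GD_swap w : GD_word w -> GD_word (swap w).
Proof.
elim=> {w} [[]|w _ IHw|w _ IHw]; try exact: GD_letter.
  by rewrite swap_morG; apply: GD_D.
by rewrite swap_morD; apply: GD_G.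
Qed.

(** The composition of the morphisms G^n E = (a^n b, a), for n in s. *)
Definition expand (s : seq nat) (w : word) : word :=
  foldr (fun n u => iter n morG (swap u)) w s.

Lemma GD_expand s w : GD_word w -> GD_word (expand s w).
Proof.
move=> bw; elim: s => [//|n s /= /GD_swap].
by elim: n => //= n IHn /IHn; apply: GD_G.
Qed.

Lemma expand_cat s u v : expand s (u ++ v) = expand s u ++ expand s v.
Proof.
elim: s => [//|n s /= ->]; rewrite /swap endo_cat; elim: n => //= n ->.
exact: endo_cat.
Qed.

Definition M_exponents (a : nat -> nat) (m : nat) : seq nat :=
  [seq if i == 1%N then (a i).-1 else a i | i <- iota 1 m].

Lemma iter_morG_a n : iter n morG [:: La] = [:: La].
Proof. by elim: n => //= n ->. Qed.

Lemma iter_morG_b n : iter n.+1 morG [:: Lb] = La :: iter n morG [:: Lb].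
Proof. by elim: n => [//|n IHn]; rewrite iterS [in LHS]IHn. Qed.

(** Appending the exponent n to the composition replaces the images (u, v) of
    (a, b) by those of (a^n b, a), that is by (u^n v, u): this is the
    recursion of the pair (M_i, M_(i-1)). *)
Lemma V0_expand a m : (forall i, (1 <= i <= m)%N -> (0 < a i)%N) ->
  V a (fun=> 0) m = embed (expand (M_exponents a m) [:: La]) /\
  Vprev a (fun=> 0) m = embed (expand (M_exponents a m) [:: Lb]).
Proof.
elim: m => [|j IHj] ha; first by split.
have [|IHV IHp] := IHj; first by move=> i /andP[? /leqW ?]; apply/ha/andP.
have -> : M_exponents a j.+1 =
    rcons (M_exponents a j) (if j == 0%N then (a j.+1).-1 else a j.+1).
  by rewrite /M_exponents -[j.+1]addn1 iotaD map_cat cats1 add1n eqSS addn1.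
set n := (if _ then _ else _).
have Eb : Defs.bseq a j.+1 = n%:Z.
  by have := ha j.+1 (leqnn _); rewrite /Defs.bseq /n eqSS; case: eqP; lia.
have expand_rcons w : expand (rcons (M_exponents a j) n) w =
    expand (M_exponents a j) (iter n morG (swap w)).
  by rewrite /expand foldr_rcons.
rewrite !expand_rcons iter_morG_a; split=> //.
rewrite VS Eb subr0 mulg1 IHV IHp.
elim: n {Eb expand_rcons} => [|n IHn]; first by rewrite mul1g.
rewrite -[swap _]/[:: Lb] in IHn *.
by rewrite iter_morG_b -(cat1s La (iter _ _ _)) expand_cat embed_cat -IHn mulgA -expgS.
Qed.

Lemma Mword_expand a m : (forall i, (1 <= i <= m)%N -> (0 < a i)%N) ->
  Mword a m = expand (M_exponents a m) [:: La].
Proof. by move=> ha; rewrite /Mword (V0_expand ha).1 to_wordK. Qed.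

Lemma count_iter_morG n w :
  count_mem La (iter n morG w) = (n * count_mem Lb w + count_mem La w)%N /\
  count_mem Lb (iter n morG w) = count_mem Lb w.
Proof.
elim: n => [//|n [IHa IHb]]; rewrite iterS.
by have [-> ->] := count_morG (iter n morG w); rewrite IHa IHb; lia.
Qed.

Lemma count_swap w :
  count_mem La (swap w) = count_mem Lb w /\
  count_mem Lb (swap w) = count_mem La w.
Proof. by rewrite /swap !count_endo /=; lia. Qed.

(** G^n E turns the numbers (A, B) of letters a and b into (n A + B, A), so the
    ratio r = B / A into 1 / (n + r); this is why the morphisms are
    peeled off from the first factor, as in the continued fraction. *)
Lemma expand_ratio s : all (leq 1) s ->
  (0 < count_mem La (expand s [:: La]))%N /\
  (count_mem Lb (expand s [:: La]))%:R
    = cfrac s * (count_mem La (expand s [:: La]))%:R :> rat.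
Proof.
elim: s => [_ /=|n s IHs /= /andP[n_gt0 /IHs[]]]; first by rewrite mul0r.
have [-> ->] := count_iter_morG n (swap (expand s [:: La])).
have [-> ->] := count_swap (expand s [:: La]).
set A := count_mem La _; set B := count_mem Lb _ => A_gt0 EB.
have gt0 : (0 < n * A + B)%N by nia.
split=> //.
have E : (n * A + B)%:R = (n%:R + cfrac s) * A%:R by rewrite natrD natrM EB mulrDl.
rewrite E mulKf //; apply/eqP => r0; move: E; rewrite r0 mul0r.
by move/eqP; rewrite pnatr_eq0; lia.
Qed.

(** The first exponent is a_1 - 1, but the Slope is a quotient by A + B rather
    than by A, which adds 1 to it. *)
Lemma slope_Mword a m : (1 <= m)%N ->
  (forall i, (1 <= i <= m)%N -> (0 < a i)%N) ->
  slope (Mword a m) = cfrac [seq a i | i <- iota 1 m].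
Proof.
case: m => // m _ ha; rewrite Mword_expand // /M_exponents /=.
have -> : [seq if i == 1%N then (a i).-1 else a i | i <- iota 2 m] =
          [seq a i | i <- iota 2 m].
  by apply/eq_in_map => i; rewrite mem_iota => /andP[/gtn_eqF ->].
have a1_gt0 : (0 < a 1%N)%N := ha 1%N isT.
have [|A_gt0 EB] := @expand_ratio [seq a i | i <- iota 2 m].
  apply/allP => x /mapP[i]; rewrite mem_iota => /andP[i_gt1 i_lt] ->.
  by apply: ha; lia.
rewrite /slope size_count.
have [-> ->] := count_iter_morG (a 1%N).-1
    (swap (expand [seq a i | i <- iota 2 m] [:: La])).
have [-> ->] := count_swap (expand [seq a i | i <- iota 2 m] [:: La]).
move: A_gt0 EB; set A := count_mem La _; set B := count_mem Lb _; set r := cfrac _.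
move=> A_gt0 EB.
have -> : ((a 1%N).-1 * A + B + A = a 1%N * A + B)%N by nia.
by rewrite natrD natrM EB -mulrDl invfM mulrCA mulfV ?mulr1 // pnatr_eq0 -lt0n.
Qed.

Unset Implicit Arguments.

Theorem theorem7p3 (m : nat) (a : nat -> nat) (hm : (1 <= m)%N)
  (ha : forall i : nat, (1 <= i <= m)%N -> (0 < a i)%N) :
  (forall d : nat -> int,
     exists h : fgroup,
       V a d m = (h^-1 * embed (Mword a m) * h)%g /\ alglen h = Nsum a d m)
  /\
  ((forall w : word,
      conj_words (Mword a m) w <->
      exists d : nat -> int, admissible a m d /\ V a d m = embed w) /\
   (forall d : nat -> int, admissible a m d ->
      V a d m = embed (iter `|Nsum a d m|%N conjugator (Mword a m))))
  /\
  (((exists w : word,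
       lower_christoffel w /\ slope w = cfrac [seq a i | i <- iota 1 m]) /\
    (forall w : word,
       lower_christoffel w -> slope w = cfrac [seq a i | i <- iota 1 m] ->
       conj_words (Mword a m) w)) /\
   ((exists w : word,
       upper_christoffel w /\ slope w = cfrac [seq a i | i <- iota 1 m]) /\
    (forall w : word,
       upper_christoffel w -> slope w = cfrac [seq a i | i <- iota 1 m] ->
       conj_words (Mword a m) w))).
Proof.
split=> [d|].
  exists (conjugating a d m); split; last exact: alglen_conjugating.
  by rewrite embed_Mword // (V_conjugating a d m).1 conjgE mulgA.
split; first by split=> [w|d]; [apply: conj_Mword_digits | apply: V_eq_iter_conjugator].
rewrite -(slope_Mword hm ha).
have bM : GD_word (Mword a m).
  by rewrite Mword_expand //; apply: GD_expand; apply: GD_letter.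
split; first exact: (@christoffel_of_GD morG morD'
    (fun w => conj_words_refl _) conj_morD _ bM).
exact: (@christoffel_of_GD morG' morD
  conj_morG (fun w => conj_words_refl _) _ bM).
Qed.
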